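(* Let $G=H\rtimes\mathbb{Z}^n$, let $\rho\colon\mathbb{Z}^n\to\mathbb{R}$ be a character, let $Q_1,Q_2\subseteq H$ be $\rho$-confining subsets, and fix $a\in\mathbb{Z}^n$ such that $\rho(a)>0$. Then $Q_1\preceq_\rho Q_2$ if and only if $Q_2^{a^k}\subseteq Q_1$ for some $k\ge0$.
   Context: Semidirect products are internal ($H$ normal in $G$, $\mathbb{Z}^n$ a complement), and $x^y=y^{-1}xy$. A character is a homomorphism to $\mathbb{R}$. A subset $Q\subseteq H$ is $\rho$-confining if $Q=Q^{-1}$ and: $Q^z\subseteq Q$ for all $z\in\mathbb{Z}^n$ with $\rho(z)\ge0$; for every $h\in H$ there is $z\in\mathbb{Z}^n$ with $h^z\in Q$; and there is $z_0\in\mathbb{Z}^n$ with $(Q\cdot Q)^{z_0}\subseteq Q$. For non-trivial $\rho$, fix a basis (or finite generating set) $\{a_1,\dots,a_n\}$ of $\mathbb{Z}^n$ and a constant $C_\rho>0$ with $|\rho(a_i)|\le C_\rho$ for all $i$ and such that $C_\rho=\rho(z_{top})$ for some $z_{top}\in\mathbb{Z}^n$; set $Z_\rho=\{z\in\mathbb{Z}^n:|\rho(z)|\le C_\rho\}$. For a $\rho$-confining $Q$, the set $Q\cup Z_\rho$ generates $G$. Write $Q_1\preceq_\rho Q_2$ if $Q_2$ is bounded in the alphabet $Q_1\cup Z_\rho$, i.e. the elements of $Q_2$ have uniformly bounded word length with respect to $Q_1\cup Z_\rho$ (this does not depend on the choices of the $a_i$ and $C_\rho$). *)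

(* Defs.v *)
From HB Require Import structures.
From mathcomp Require Import all_boot all_order all_algebra.
From mathcomp Require Import boolp classical_sets reals.

Set Implicit Arguments.
Unset Strict Implicit.
Unset Printing Implicit Defensive.

Import Order.TTheory GRing.Theory Num.Theory.

Local Open Scope classical_set_scope.
Local Open Scope ring_scope.

(* [t] identifies the additive group Z^n = 'rV[int]_n with a subgroup
   [range t] of the (multiplicative, possibly infinite) group [G]. *)
Record semidirect_Zn (G : groupType) (H : set G) (n : nat)
    (t : 'rV[int]_n -> G) : Prop := SemidirectZn {
  sdZn_subgroup : group_closed [in H] ;
  sdZn_normal : forall h g : G, H h -> H (h ^ g)%g ;
  sdZn_morph : {morph t : u v / u + v >-> (u * v)%g} ;
  sdZn_inj : injective t ;
  sdZn_trivial : H `&` range t = [set 1%g] ;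
  sdZn_full : [set (h * g)%g | h in H & g in range t] = [set: G] }.

(* In this library [x ^ y] in groups is [y^-1 * (x * y)]. *)
Definition conj_set (G : groupType) (Q : set G) (g : G) : set G :=
  [set (q ^ g)%g | q in Q].

Record confining (R : realType) (G : groupType) (H : set G) (n : nat)
    (t : 'rV[int]_n -> G) (rho : 'rV[int]_n -> R) (Q : set G) : Prop :=
  Confining {
  conf_sub : Q `<=` H ;
  conf_sym : Q = [set (q^-1)%g | q in Q] ;
  conf_stable : forall z, 0 <= rho z -> conj_set Q (t z) `<=` Q ;
  conf_absorb : forall h, H h -> exists z, Q (h ^ t z)%g ;
  conf_prod : exists z0,
    conj_set [set (p * q)%g | p in Q & q in Q] (t z0) `<=` Q }.

Definition word_length_le (G : groupType) (S : set G) (N : nat) (x : G)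
    : Prop :=
  exists w : seq G, [/\ (size w <= N)%N,
    forall s, s \in w -> S s \/ S (s^-1)%g
    & x = (\prod_(s <- w) s)%g].

Definition bounded_in (G : groupType) (S T : set G) : Prop :=
  exists N : nat, forall x, T x -> word_length_le S N x.

Definition generates_Zn (n m : nat) (e : 'I_m -> 'rV[int]_n) : Prop :=
  forall z : 'rV[int]_n, exists c : 'I_m -> int, z = \sum_(i < m) e i *~ c i.

Record admissible (R : realType) (n : nat) (rho : 'rV[int]_n -> R)
    (m : nat) (e : 'I_m -> 'rV[int]_n) (C : R) : Prop := Admissible {
  adm_gen : generates_Zn e ;
  adm_pos : 0 < C ;
  adm_bound : forall i, `|rho (e i)| <= C ;
  adm_top : exists ztop, C = rho ztop }.

Definition Zrho (R : realType) (n : nat) (rho : 'rV[int]_n -> R) (C : R)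
    : set 'rV[int]_n :=
  [set z | `|rho z| <= C].

Definition preceq (R : realType) (G : groupType) (n : nat)
    (t : 'rV[int]_n -> G) (rho : 'rV[int]_n -> R) (C : R) (Q1 Q2 : set G)
    : Prop :=
  bounded_in (Q1 `|` t @` Zrho rho C) Q2.

(* Main.v *)
Require Import Defs.
From HB Require Import structures.
From mathcomp Require Import all_boot all_order all_algebra.
From mathcomp Require Import boolp classical_sets reals.

(** Suppose first that every element [x] of [Q2] is a word of length at most
    [N] in [Q1] and [t @` Zrho rho C]. Pushing the letters from Z^n to the
    right writes [x] as [h * t v], where [h] is a product of at most [N]
    conjugates of elements of [Q1] by elements of Z^n of bounded character.
    Since [x] and [h] lie in [H], which meets Z^n trivially, [x = h]. A
    conjugation by an element of large character carries each factor back
    into [Q1], and conjugation by [z0] absorbs each product of two elements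
    of [Q1]; so one bound, linear in [N], ensures that [x ^ t u] is in [Q1]
    as soon as [rho u] exceeds it. A large multiple of [a] serves as [u].
    [confining_word_split] carries this out by induction on the word.

    Conversely, [Q2 ^ (t a ^+ k) `<=` Q1] makes each element of [Q2] a
    conjugate of an element of [Q1] by the single element [t a ^+ k], which
    has a finite length in the letters [t @` Zrho rho C], because these
    contain the images of generators of Z^n ([word_length_le_Zn]). *)

Set Implicit Arguments.
Unset Strict Implicit.
Unset Printing Implicit Defensive.

Import Order.TTheory GRing.Theory Num.Theory.

Local Open Scope classical_set_scope.
Local Open Scope ring_scope.

(** * Word length *)

Lemma word_length_le_one (G : groupType) (S : set G) :
  word_length_le S 0 1%g.
Proof. by exists [::]; split=> //; rewrite big_nil. Qed.

Lemma word_length_le_gen (G : groupType) (S : set G) x :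
  S x -> word_length_le S 1 x.
Proof.
move=> Sx; exists [:: x]; split=> //; last by rewrite big_seq1.
by move=> s; rewrite inE => /eqP ->; left.
Qed.

Lemma word_length_le_mul (G : groupType) (S : set G) N1 N2 x1 x2 :
  word_length_le S N1 x1 -> word_length_le S N2 x2 ->
  word_length_le S (N1 + N2) (x1 * x2)%g.
Proof.
move=> [w1 [l1 s1 ->]] [w2 [l2 s2 ->]]; exists (w1 ++ w2); split.
- by rewrite size_cat leq_add.
- by move=> s; rewrite mem_cat => /orP[/s1|/s2].
- by rewrite big_cat.
Qed.

Lemma word_length_le_inv (G : groupType) (S : set G) N x :
  word_length_le S N x -> word_length_le S N (x^-1)%g.
Proof.
move=> [w [lw sw ->]]; exists [seq (s^-1)%g | s <- rev w]; split.
- by rewrite size_map size_rev.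
- by move=> _ /mapP[s sinw ->]; rewrite mem_rev in sinw; rewrite invgK;
    case: (sw s sinw); [right|left].
- by rewrite big_map prodgV revK.
Qed.

(** * Homomorphisms from Z^n *)

Section ZnMorphism.

Variables (G : groupType) (n : nat) (t : 'rV[int]_n -> G).
Hypothesis tD : {morph t : u v / u + v >-> (u * v)%g}.

Lemma morphZn0 : t 0 = 1%g.
Proof. by apply: (@mulgI _ (t 0)); rewrite -tD addr0 mulg1. Qed.

Lemma morphZnN u : t (- u) = (t u)^-1%g.
Proof. by apply: (@mulgI _ (t u)); rewrite -tD subrr mulgV morphZn0. Qed.

Lemma morphZnMn u k : t (u *+ k) = (t u ^+ k)%g.
Proof.
by elim: k => [|k IHk]; rewrite ?mulr0n ?morphZn0 // mulrS tD IHk expgS.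
Qed.

(** Elements of finite word length form a subgroup, so it suffices that the generators themselves are letters. *)
Lemma word_length_le_Zn (S : set G) (m : nat) (e : 'I_m -> 'rV[int]_n) :
  generates_Zn e -> (forall i, S (t (e i))) ->
  forall z, exists N, word_length_le S N (t z).
Proof.
move=> gen Se z; have [c ->] := gen z.
pose P u := exists N, word_length_le S N (t u).
have PD u v : P u -> P v -> P (u + v).
  by move=> [N1 w1] [N2 w2]; exists (N1 + N2)%N; rewrite tD;
    apply: word_length_le_mul.
have PN u : P u -> P (- u).
  by move=> [N w]; exists N; rewrite morphZnN; apply: word_length_le_inv.
have P0 : P 0 by exists 0%N; rewrite morphZn0; apply: word_length_le_one.
have PMn u k : P u -> P (u *+ k).
  by move=> Pu; elim: k => [|k IHk]; rewrite ?mulr0n // mulrS; apply: PD.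
apply: (big_ind P) => // i _.
have Pe : P (e i) by exists 1%N; apply: word_length_le_gen.
by case: (c i) => k; [exact: PMn|apply: PN; exact: PMn].
Qed.

End ZnMorphism.

(** * Absorption of words by a confining set *)

Section Absorption.

Variables (R : realType) (G : groupType) (H : set G) (n : nat).
Variables (t : 'rV[int]_n -> G) (rho : {additive 'rV[int]_n -> R}).
Hypothesis tD : {morph t : u v / u + v >-> (u * v)%g}.
Variable Q : set G.
Hypothesis confQ : confining H t rho Q.

(** Some conjugate of the identity lies in [Q], and it is the identity. *)
Lemma confining_one : H 1%g -> Q 1%g.
Proof. by move=> /(conf_absorb confQ)[z]; rewrite conj1g. Qed.

Lemma confining_inv s : Q (s^-1)%g -> Q s.
Proof. by move=> Qs; rewrite (conf_sym confQ); exists s^-1%g; rewrite ?invgK. Qed.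

(** Unlike membership in [Q], this property passes to products and to
    conjugates by Z^n, at the price of a controlled increase of [c]. *)
Definition absorbed_above (c : R) (h : G) : Prop :=
  forall u, c <= rho u -> Q (h ^ t u)%g.

Lemma absorbed_above_mem h : Q h -> absorbed_above 0 h.
Proof. by move=> Qh u ru; apply: (conf_stable confQ ru); exists h. Qed.

Lemma absorbed_above_le c d h :
  c <= d -> absorbed_above c h -> absorbed_above d h.
Proof. by move=> cd hc u du; apply: hc; apply: le_trans du. Qed.

Lemma absorbed_above_conj c h v :
  absorbed_above c h -> absorbed_above (c - rho v) (h ^ t v)%g.
Proof.
by move=> hc u cu; rewrite -conjgM -tD; apply: hc; rewrite raddfD -lerBlDl.
Qed.

(** The conjugation by [t u] is performed in two steps: first by
    [t (u - z0)], which brings both factors into [Q], then by [t z0], which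
    brings their product back into [Q]. *)
Lemma absorbed_above_mul c z0 g h :
  conj_set [set (p * q)%g | p in Q & q in Q] (t z0) `<=` Q ->
  absorbed_above c g -> absorbed_above c h ->
  absorbed_above (c + rho z0) (g * h)%g.
Proof.
move=> QQ gc hc u cu.
have cu0 : c <= rho (u - z0) by rewrite raddfB lerBrDr.
rewrite -(subrK z0 u) tD conjgM conjMg; apply: QQ.
exists (g ^ t (u - z0) * h ^ t (u - z0))%g => //.
by exists (g ^ t (u - z0))%g; [exact: gc|]; exists (h ^ t (u - z0))%g;
  [exact: hc|].
Qed.

(** Reading the word from its right end, each letter from [Q] costs at most
    [`|rho z0|] (one product) and each letter from Z^n at most [C] (one
    conjugation), so the height grows linearly in the length. *)
Lemma confining_word_split (C : R) z0 (w : seq G) :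
  H 1%g -> 0 <= C ->
  conj_set [set (p * q)%g | p in Q & q in Q] (t z0) `<=` Q ->
  (forall s, s \in w ->
     (Q `|` t @` Zrho rho C) s \/ (Q `|` t @` Zrho rho C) (s^-1)%g) ->
  exists h v, (\prod_(s <- w) s)%g = (h * t v)%g /\
    absorbed_above ((`|rho z0| + C) *+ size w) h.
Proof.
move=> H1 C0 QQ; set D := `|rho z0| + C.
have D0 : 0 <= D by rewrite addr_ge0.
elim: w => [|s w IHw] letters.
  exists 1%g, 0; rewrite big_nil (morphZn0 tD) mulg1; split=> //.
  by apply: absorbed_above_mem; apply: confining_one.
have [|h [v [Ew habs]]] := IHw.
  by move=> r rw; apply: letters; rewrite inE rw orbT.
have Dw0 : 0 <= D *+ size w by rewrite mulrn_wge0.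
have [Qs|[y yC Es]] : Q s \/ exists2 y, `|rho y| <= C & s = t y.
  have [[Qs|[y yC <-]]|[Qs|[y yC Es]]] := letters s (mem_head _ _).
  - by left.
  - by right; exists y.
  - by left; apply: confining_inv.
  - right; exists (- y); first by rewrite raddfN normrN.
    by rewrite (morphZnN tD) Es invgK.
- exists (s * h)%g, v; rewrite big_cons Ew mulgA; split=> //.
  apply: (@absorbed_above_le (D *+ size w + rho z0)).
    rewrite /= mulrSr lerD2l.
    by rewrite (le_trans (ler_norm _)) // lerDl.
  apply: absorbed_above_mul => //.
  by apply: absorbed_above_le (absorbed_above_mem Qs).
- exists (h ^ t (- y))%g, (y + v); rewrite big_cons Ew Es; split.
    by rewrite tD (morphZnN tD) conjgE invgK !mulgA mulgVK.
  apply: (@absorbed_above_le (D *+ size w - rho (- y))).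
    rewrite /= mulrSr lerD2l raddfN opprK.
    by rewrite (le_trans (ler_norm _)) // (le_trans yC) // lerDr.
  exact: absorbed_above_conj.
Qed.

End Absorption.

Theorem corollary2p8 (R : realType) (G : groupType) (H : set G) (n : nat)
    (t : 'rV[int]_n -> G) (hG : semidirect_Zn H t)
    (rho : {additive 'rV[int]_n -> R})
    (m : nat) (e : 'I_m -> 'rV[int]_n) (C : R) (hC : admissible rho e C)
    (Q1 Q2 : set G) (hQ1 : confining H t rho Q1) (hQ2 : confining H t rho Q2)
    (a : 'rV[int]_n) (ha : 0 < rho a) :
  preceq t rho C Q1 Q2 <->
    exists k : nat, conj_set Q2 (t a ^+ k)%g `<=` Q1.
Proof.
have [[H1 HB] HJ tD _ Htriv _] := hG; have C0 := adm_pos hC.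
have Hone : H 1%g by rewrite inE in H1.
have HM p q : H p -> H q -> H (p * q)%g.
  have := group_closedM (conj H1 HB) => HM Hp Hq.
  by have := HM p q; rewrite !inE; apply.
have HV p : H p -> H p^-1%g.
  have := group_closedV (conj H1 HB) => HV Hp.
  by have := HV p; rewrite !inE; apply.
split=> [[N bdd]|[k sub]].
- have [z0 QQ] := conf_prod hQ1.
  set D := `|rho z0| + C.
  have D0 : 0 <= D by rewrite addr_ge0 // ltW.
  pose k := Num.bound (D *+ N / rho a).
  have kN : D *+ N <= rho (a *+ k).
    rewrite raddfMn -[_ *+ k]mulr_natl -ler_pdivrMr //.
    by rewrite ltW // archi_boundP // divr_ge0 ?mulrn_wge0 // ltW.
  exists k => _ [x Q2x <-]; have [w [lw letters Ex]] := bdd x Q2x.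
  have [h [v [Eh habs]]] :=
    confining_word_split tD hQ1 Hone (ltW C0) QQ letters.
  have hQ : Q1 (h ^ t (a *+ k))%g.
    apply: habs; apply: le_trans kN.
    by rewrite ler_wpMn2l.
  have Hh : H h.
    by rewrite -(conjgK (t (a *+ k)) h); apply/HJ/(conf_sub hQ1).
  (* The factor of [x] in Z^n also lies in [H], hence is trivial. *)
  have tv : t v = 1%g.
    have : (H `&` range t) (t v).
      split; last by exists v.
      rewrite -(mulKg h (t v)) -Eh -Ex.
      by apply: HM; [exact: HV|exact: (conf_sub hQ2)].
    by rewrite Htriv.
  by rewrite Ex Eh tv mulg1 -(morphZnMn tD).
- have [|N tN] := word_length_le_Zn (S := Q1 `|` t @` Zrho rho C)
    tD (adm_gen hC) _ (a *+ k).
    by move=> i; right; exists (e i) => //; apply: (adm_bound hC).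
  rewrite (morphZnMn tD) in tN.
  exists (N + (1 + N))%N => x Q2x.
  have -> : x = (t a ^+ k * (x ^ (t a ^+ k) * (t a ^+ k)^-1))%g.
    by rewrite conjgE -!mulgA mulgV mulg1 mulVKg.
  apply: word_length_le_mul => //; apply: word_length_le_mul.
    by apply: word_length_le_gen; left; apply: sub; exists x.
  exact: word_length_le_inv.
Qed.
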